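(* Let $\mathcal{D}_1\subseteq\mathbb{R}$ be connected, let $\mathcal{D}_2\subset\mathbb{R}^N$ be compact, and let $g:\mathcal{D}_1\times\mathcal{D}_2\to\mathbb{R}$ be continuously differentiable. Let $f(\varepsilon)=\max_{x\in\mathcal{D}_2} g(\varepsilon,x)$. Suppose that $\varepsilon_{\mathrm{lb}},\varepsilon_0\in\mathcal{D}_1$ with $\varepsilon_{\mathrm{lb}}<\varepsilon_0$ and $x_0\in\mathcal{D}_2$ satisfy $f(\varepsilon_{\mathrm{lb}})<0\le g(\varepsilon_0,x_0)\le f(\varepsilon_0)$, and that the Hybrid Expansion-Contraction (HEC) algorithm described in the context is run from this initial data with root-finding and optimization subroutines satisfying the subroutine assumptions in the context. Then HEC generates a sequence $\{\varepsilon_k\}$ that converges monotonically to a limit $\tilde\varepsilon$ and a sequence $\{x_k\}$ with at least one cluster point, and for every cluster point $\tilde x$ of $\{x_k\}$ the pair $(\tilde\varepsilon,\tilde x)$ is a pseudoroot, i.e., $g(\tilde\varepsilon,\tilde x)=0$ and $\tilde x$ is a stationary point of $x\mapsto g(\tilde\varepsilon,x)$. (If HEC terminates after finitely many iterations, then $(\tilde\varepsilon,\tilde x)$ denotes the returned pair, and it is a pseudoroot.)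
   Context: Notation: for fixed $x\in\mathcal{D}_2$, $g_x(\varepsilon):=g(\varepsilon,x)$ on $\mathcal{D}_1$; for fixed $\varepsilon\in\mathcal{D}_1$, $g_\varepsilon(x):=g(\varepsilon,x)$ on $\mathcal{D}_2$. A stationary point of $g_\varepsilon$ is a point $x$ with $\nabla g_\varepsilon(x)=0$. The root-max problem is to find $\varepsilon\in\mathcal{D}_1$ with $f(\varepsilon)=\max_{x\in\mathcal{D}_2}g_\varepsilon(x)=0$. A pair $(\tilde\varepsilon,\tilde x)\in\mathcal{D}_1\times\mathcal{D}_2$ is a pseudoroot of this problem if $g(\tilde\varepsilon,\tilde x)=0$ and $\tilde x$ is a stationary point of $g_{\tilde\varepsilon}$. HEC algorithm. Input: $\varepsilon_{\mathrm{lb}},\varepsilon_0,x_0$ as in the claim. For $k=0,1,2,\dots$: (1) Contraction: compute $\hat\varepsilon_k\in(\varepsilon_{\mathrm{lb}},\varepsilon_k]$ with $g_{x_k}(\hat\varepsilon_k)=0$, using the root-finding subroutine initialized at $\varepsilon_k$ (such a root exists since $g_{x_k}(\varepsilon_{\mathrm{lb}})<0\le g_{x_k}(\varepsilon_k)$; if $g_{x_k}(\varepsilon_k)=0$, then $\hat\varepsilon_k=\varepsilon_k$ is returned). (2) If $x_k$ is a stationary point of $g_{\hat\varepsilon_k}$, return $(\tilde\varepsilon,\tilde x)=(\hat\varepsilon_k,x_k)$ and stop. (3) Expansion: compute a stationary point $x_{k+1}\in\mathcal{D}_2$ of $g_{\hat\varepsilon_k}$ with $g_{\hat\varepsilon_k}(x_{k+1})>g_{\hat\varepsilon_k}(x_k)$,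 using the optimization subroutine initialized at $x_k$. (4) Set $\varepsilon_{k+1}:=\hat\varepsilon_k$. Subroutine assumptions: both subroutines are deterministic (same output for same initial data) and converge exactly (exact roots; exact stationary points, i.e., zero gradient); the root-finding method uses bracketing to ensure convergence to a root in the given bracket; the optimization solver is monotonic, i.e., it always increases the objective value at successive iterates until it reaches a stationary point. *)

(* Defs.v *)
From HB Require Import structures.
From mathcomp Require Import all_boot all_order all_algebra.
From mathcomp Require Import all_classical all_reals all_analysis.

Set Implicit Arguments.
Unset Strict Implicit.
Unset Printing Implicit Defensive.

Import Order.TTheory GRing.Theory Num.Theory.
Import numFieldNormedType.Exports.

Local Open Scope classical_set_scope.
Local Open Scope ring_scope.

Definition is_maximum (R : realType) (A : set R) (m : R) : Prop :=
  A m /\ ubound A m.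

(* Continuity of every directional derivative is the same as continuity of the
   differential ['d h], because this is only used on finite-dimensional spaces. *)
Definition continuously_differentiable_on (R : realType) (V : normedModType R)
    (U : set V) (h : V -> R) : Prop :=
  forall p, U p ->
    differentiable h p /\ forall v : V, {for p, continuous (fun q => 'D_v h q)}.

(* [D1] and [D2] need not be open: [C^1] on [D1 `*` D2] means, as usual, [C^1] on
   some open neighbourhood. The values of [g] outside of it are irrelevant. *)
Definition C1_on_product (R : realType) (N : nat) (D1 : set R)
    (D2 : set 'rV[R]_N) (g : R -> 'rV[R]_N -> R) : Prop :=
  exists U : set (R^o * 'rV[R]_N),
    [/\ open U, D1 `*` D2 `<=` U
      & continuously_differentiable_on U
          (fun p : R^o * 'rV[R]_N => g p.1 p.2)].

Definition gradient (R : realType) (N : nat) (h : 'rV[R]_N -> R)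
    (x : 'rV[R]_N) : 'rV[R]_N :=
  \row_i 'D_(delta_mx 0 i) h x.

Definition stationary (R : realType) (N : nat) (h : 'rV[R]_N -> R)
    (x : 'rV[R]_N) : Prop :=
  gradient h x = 0.

Definition pseudoroot (R : realType) (N : nat) (D1 : set R)
    (D2 : set 'rV[R]_N) (g : R -> 'rV[R]_N -> R)
    (e : R) (x : 'rV[R]_N) : Prop :=
  [/\ D1 e, D2 x, g e x = 0 & stationary (g e) x].

(* [root_finder phi a b] is the root returned for the function [phi], the
   bracket [`[a, b]] and the initial point [b]. Being a function of these data
   is what makes the method deterministic. *)
Definition root_finder (R : realType) : Type := (R -> R) -> R -> R -> R.

(* [optimizer h y] is the sequence of iterates for maximizing [h] from the
   initial point [y]; the computed point is the limit of this sequence. *)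
Definition optimizer (R : realType) (N : nat) : Type :=
  ('rV[R]_N -> R) -> 'rV[R]_N -> nat -> 'rV[R]_N.

Definition opt_result (R : realType) (N : nat) (opt : optimizer R N)
    (h : 'rV[R]_N -> R) (y : 'rV[R]_N) : 'rV[R]_N :=
  limn (opt h y).

Definition root_call_ok (R : realType) (root : root_finder R)
    (phi : R -> R) (a b : R) : Prop :=
  a < b -> phi a < 0 -> 0 <= phi b ->
  [/\ a <= root phi a b <= b, phi (root phi a b) = 0
    & phi b = 0 -> root phi a b = b].

(* A solver that reaches a stationary point after finitely many iterations
   stops there; its sequence of iterates is then constant from that index on. *)
Definition opt_call_ok (R : realType) (N : nat) (D : set 'rV[R]_N)
    (opt : optimizer R N) (h : 'rV[R]_N -> R) (y : 'rV[R]_N) : Prop :=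
  [/\ opt h y 0%N = y,
      forall n, D (opt h y n),
      forall n, ~ stationary h (opt h y n) ->
        h (opt h y n) < h (opt h y n.+1),
      forall n, stationary h (opt h y n) -> opt h y n.+1 = opt h y n
    & cvgn (opt h y) /\ stationary h (opt_result opt h y)].

Inductive hec_state (R : realType) (N : nat) : Type :=
  | Running of R & 'rV[R]_N
  | Returned of R & 'rV[R]_N.

Definition contraction (R : realType) (N : nat) (g : R -> 'rV[R]_N -> R)
    (root : root_finder R) (elb e : R) (x : 'rV[R]_N) : R :=
  root (fun t => g t x) elb e.

Definition expansion (R : realType) (N : nat) (g : R -> 'rV[R]_N -> R)
    (opt : optimizer R N) (ehat : R) (x : 'rV[R]_N) : 'rV[R]_N :=
  opt_result opt (g ehat) x.

Definition hec_step (R : realType) (N : nat) (g : R -> 'rV[R]_N -> R)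
    (root : root_finder R) (opt : optimizer R N) (elb : R)
    (s : hec_state R N) : hec_state R N :=
  match s with
  | Running e x =>
      let ehat := contraction g root elb e x in
      if `[< stationary (g ehat) x >] then Returned ehat x
      else Running ehat (expansion g opt ehat x)
  | Returned e x => Returned e x
  end.

(* [hec g root opt elb e0 x0 k] is [Running e x] if iteration [k] is reached,
   with current iterates [e] and [x]; it is [Returned e x] if the algorithm has
   returned [(e, x)] before iteration [k]. *)
Definition hec (R : realType) (N : nat) (g : R -> 'rV[R]_N -> R)
    (root : root_finder R) (opt : optimizer R N) (elb e0 : R)
    (x0 : 'rV[R]_N) (k : nat) : hec_state R N :=
  iter k (hec_step g root opt elb) (Running e0 x0).

(* The subroutines are only required to behave well on the calls that the run
   actually makes. *)
Definition subroutines_ok (R : realType) (N : nat) (D2 : set 'rV[R]_N)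
    (g : R -> 'rV[R]_N -> R) (root : root_finder R) (opt : optimizer R N)
    (elb e0 : R) (x0 : 'rV[R]_N) : Prop :=
  forall k e x, hec g root opt elb e0 x0 k = Running e x ->
    let ehat := contraction g root elb e x in
    root_call_ok root (fun t => g t x) elb e /\
    (~ stationary (g ehat) x -> opt_call_ok D2 opt (g ehat) x).

(* Every iteration that is reached can be carried out as specified: the
   contraction yields a root in the half-open bracket, and the expansion, when
   it is needed, yields a stationary point with a larger objective value. *)
Definition hec_steps_succeed (R : realType) (N : nat) (D1 : set R)
    (D2 : set 'rV[R]_N) (g : R -> 'rV[R]_N -> R) (root : root_finder R)
    (opt : optimizer R N) (elb e0 : R) (x0 : 'rV[R]_N) : Prop :=
  forall k e x, hec g root opt elb e0 x0 k = Running e x ->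
    let ehat := contraction g root elb e x in
    let x' := expansion g opt ehat x in
    [/\ D1 e, D2 x,
        elb < ehat <= e,
        g ehat x = 0
      & ~ stationary (g ehat) x ->
        [/\ D2 x', stationary (g ehat) x' & g ehat x < g ehat x']].

(* Main.v *)
Require Import Defs.
From HB Require Import structures.
From mathcomp Require Import all_boot all_order all_algebra.
From mathcomp Require Import all_classical all_reals all_analysis.

Set Implicit Arguments.
Unset Strict Implicit.
Unset Printing Implicit Defensive.

Import Order.TTheory GRing.Theory Num.Theory.
Import numFieldNormedType.Exports.

Local Open Scope classical_set_scope.
Local Open Scope ring_scope.

(** While it runs, the algorithm holds a pair [(e, x)] with [elb < e] and
[0 <= g e x], so that [`[elb, e]] brackets a root of [g ^~ x]: contraction
gives [g ehat x = 0], and expansion then makes [g ehat x'] positive, since a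
monotone solver started at a nonstationary point improves strictly at its first
iterate and loses nothing in the limit ([opt_result_increases]). Hence no step
can fail ([hec_succeeds]), and a returned pair is a pseudoroot by the stopping
test ([hec_invariant]).

If the algorithm never stops, [eps] decreases and is bounded below by [elb], so
it has a limit [et], which lies in the interval [D1]; compactness of [D2] gives
cluster points of [xs]. Two equations hold along the run: [g eps_{k+1}] vanishes
at [x_k] (contraction) and is stationary at [x_{k+1}] (expansion). As [g] and
its partial derivatives in [x] are jointly continuous, both equations pass to
the limit [et] and to any cluster point ([cluster_pair_zero]). The first one
shifts the indices of [eps] and [xs] against each other, which is harmless
because all of [eps] converges: only the second component has to be followed
along a subfamily. *)

(** The C^1 hypothesis is about [g] as a function on the product space, whereas
stationarity is about its sections; this identity translates between them. *)
Lemma partial_derivative_pair (R : realType) (N : nat) (g : R -> 'rV[R]_N -> R)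
    (e : R) (x v : 'rV[R]_N) :
  'D_v (g e) x = 'D_((0, v) : R^o * 'rV[R]_N) (fun p => g p.1 p.2) (e, x).
Proof.
rewrite /derive; set F := (X in lim (X @ _)); set G := (X in _ = lim (X @ _)).
suff -> : F = G by [].
by apply/funext => h; rewrite /F /G /= scaler0 add0r.
Qed.

(** The set of indices at which [w] is close to [b] is merely infinite, while
[u] is eventually close to [a]; these two requirements are compatible, so [phi]
has zeros arbitrarily near [(a, b)]. *)
Lemma cluster_pair_zero (R : realType) (V W : normedModType R)
    (phi : V * W -> R) (u : nat -> V) (w : nat -> W) (a : V) (b : W) :
  {for (a, b), continuous phi} ->
  u @ \oo --> a -> cluster (w @ \oo) b ->
  (\forall k \near \oo, phi (u k, w k) = 0) ->
  phi (a, b) = 0.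
Proof.
move=> phi_cont u_cvg w_cluster phi_uw; apply: contrapT => /eqP phi_neq0.
have [[A B] /= [nA nB] AB_neq0] :
    nbhs (a, b) [set p | phi p != 0].
  apply: (phi_cont [set z | z != 0]).
  by apply: open_nbhs_nbhs; split => //; exact: open_neq.
(* Images under [w] of the indices [k] are used, because the cluster property
   only speaks of subsets of the target space. *)
have nE : (w @ \oo) (w @` [set k | A (u k) /\ phi (u k, w k) = 0]).
  have nearA : \forall k \near \oo, A (u k) by exact: u_cvg.
  apply: filterS (filterI nearA phi_uw) => k k_ok.
  by exists k.
have [_ [[k [Auk phi0] <-] Bwk]] := w_cluster _ _ nE nB.
by have := AB_neq0 (u k, w k) (conj Auk Bwk); rewrite /= phi0 eqxx.
Qed.

Lemma C1_pair_continuous (R : realType) (N : nat) (D1 : set R)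
    (D2 : set 'rV[R]_N) (g : R -> 'rV[R]_N -> R) (e : R) (x : 'rV[R]_N) :
  C1_on_product D1 D2 g -> D1 e -> D2 x ->
  {for ((e, x) : R^o * 'rV[R]_N), continuous (fun p => g p.1 p.2)}.
Proof.
move=> [U [_ subU C1]] De Dx.
by have [/differentiable_continuous] := C1 (e, x) (subU (e, x) (conj De Dx)).
Qed.

Lemma C1_partial_continuous (R : realType) (N : nat) (D1 : set R)
    (D2 : set 'rV[R]_N) (g : R -> 'rV[R]_N -> R) (e : R) (x v : 'rV[R]_N) :
  C1_on_product D1 D2 g -> D1 e -> D2 x ->
  {for ((e, x) : R^o * 'rV[R]_N), continuous (fun p => 'D_v (g p.1) p.2)}.
Proof.
move=> [U [_ subU C1]] De Dx.
have [_ /(_ (0, v))] := C1 (e, x) (subU (e, x) (conj De Dx)).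
have -> // : (fun p : R^o * 'rV[R]_N => 'D_v (g p.1) p.2) =
  (fun p : R^o * 'rV[R]_N =>
     'D_((0, v) : R^o * 'rV[R]_N) (fun q => g q.1 q.2) p).
by apply/funext => -[e' x']; exact: partial_derivative_pair.
Qed.

Lemma C1_section_continuous (R : realType) (N : nat) (D1 : set R)
    (D2 : set 'rV[R]_N) (g : R -> 'rV[R]_N -> R) (e : R) (x : 'rV[R]_N) :
  C1_on_product D1 D2 g -> D1 e -> D2 x -> {for x, continuous (g e)}.
Proof.
move=> gC1 De Dx.
have gc := C1_pair_continuous gC1 De Dx.
have pair_cont : {for x, continuous (fun y => (e, y) : R^o * 'rV[R]_N)}.
  move=> S [[A B] [/= nA nB] subS].
  apply: filterS nB => y By; apply: (subS (e, y)).
  by split=> //; exact: nbhs_singleton nA.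
exact: (continuous_comp pair_cont gc).
Qed.

(** Reduces the vanishing of a gradient to scalar equations, the form required
by [cluster_pair_zero]. *)
Lemma stationary_partial (R : realType) (N : nat) (h : 'rV[R]_N -> R)
    (x : 'rV[R]_N) :
  stationary h x <-> forall i, 'D_(delta_mx 0 i) h x = 0.
Proof.
split=> [/rowP grad0 i | grad0]; first by have := grad0 i; rewrite !mxE.
by apply/rowP => i; rewrite !mxE.
Qed.

(** The first iterate already improves strictly on [y], and the values along the
iterates never decrease afterwards, so the gain survives in the limit, where [h]
takes the limit of these values by continuity. *)
Lemma opt_result_increases (R : realType) (N : nat) (D : set 'rV[R]_N)
    (opt : optimizer R N) (h : 'rV[R]_N -> R) (y : 'rV[R]_N) :
  compact D -> (forall x, D x -> {for x, continuous h}) ->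
  opt_call_ok D opt h y -> ~ stationary h y ->
  [/\ D (opt_result opt h y), stationary h (opt_result opt h y)
    & h y < h (opt_result opt h y)].
Proof.
move=> cptD hC [opt0 optD optS optE [cvg_opt stat_lim]] nstat.
have clD : closed D by apply: compact_closed => //; exact: norm_hausdorff.
have Dlim : D (opt_result opt h y).
  by apply: (closed_cvg D clD _ _ cvg_opt); exact: nearW.
split=> //.
(* At a stationary iterate the solver is constant, hence only weak monotonicity. *)
have opt_mono : nondecreasing_seq (h \o opt h y).
  apply/nondecreasing_seqP => n /=.
  have [st|nst] := pselect (stationary h (opt h y n)); first by rewrite optE.
  exact: ltW (optS _ nst).
have cvg_h : (h \o opt h y) @ \oo --> h (opt_result opt h y).
  exact: (cvg_comp _ _ cvg_opt (hC _ Dlim)).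
have step1 : h y < h (opt h y 1%N) by have := optS 0%N; rewrite opt0; apply.
apply: lt_le_trans step1 _.
rewrite -(cvg_lim _ cvg_h) //.
apply: (nondecreasing_cvgn_le opt_mono).
by apply/cvg_ex; exists (h (opt_result opt h y)).
Qed.

Lemma connected_between (R : realType) (D : set R) (a b c : R) :
  connected D -> D a -> D b -> a <= c <= b -> D c.
Proof.
by move=> /connected_intervalP D_itv Da Db; apply: D_itv; [exact: Da|exact: Db].
Qed.

Section HECRun.
Variables (R : realType) (N : nat) (D1 : set R) (D2 : set 'rV[R]_N).
Variables (g : R -> 'rV[R]_N -> R) (root : root_finder R) (opt : optimizer R N).
Variables (elb e0 : R) (x0 : 'rV[R]_N).
Hypothesis D1_connected : connected D1.
Hypothesis D2_compact : compact D2.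
Hypothesis g_C1 : C1_on_product D1 D2 g.
Hypothesis D1_elb : D1 elb.
Hypothesis g_elb_lt0 : forall x, D2 x -> g elb x < 0.

(** Together with [g elb x < 0], the two inequalities say that [elb] and [e]
form a bracket for a root of [fun t => g t x]. *)
Definition bracketing_pair (e : R) (x : 'rV[R]_N) : Prop :=
  [/\ D1 e, D2 x, elb < e & 0 <= g e x].

(** The loop invariant of the algorithm. *)
Definition hec_state_ok (s : hec_state R N) : Prop :=
  match s with
  | Running e x => bracketing_pair e x
  | Returned e x => pseudoroot D1 D2 g e x
  end.

(** The root returned lies in the closed bracket; it differs from [elb] because
[g elb] is negative on all of [D2]. *)
Lemma contraction_spec e x :
  bracketing_pair e x -> root_call_ok root (fun t => g t x) elb e ->
  let ehat := Defs.contraction g root elb e x in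
  [/\ D1 ehat, elb < ehat <= e & g ehat x = 0].
Proof.
move=> [D1e D2x elb_lt g_ge0] root_ok /=.
have [] := root_ok elb_lt (g_elb_lt0 D2x) g_ge0.
rewrite -/(Defs.contraction g root elb e x).
set ehat := Defs.contraction _ _ _ _ _ => /andP[le1 le2] g0 _.
split=> //; first by apply: (connected_between D1_connected D1_elb D1e); rewrite le1.
rewrite le2 andbT lt_neqAle le1 andbT; apply/eqP => E.
by have := g_elb_lt0 D2x; rewrite E g0 ltxx.
Qed.

Lemma expansion_spec ehat x :
  D1 ehat -> opt_call_ok D2 opt (g ehat) x -> ~ stationary (g ehat) x ->
  let x' := expansion g opt ehat x in
  [/\ D2 x', stationary (g ehat) x' & g ehat x < g ehat x'].
Proof.
move=> D1e; apply: opt_result_increases => // y D2y.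
exact: C1_section_continuous g_C1 D1e D2y.
Qed.

Hypothesis start_ok : bracketing_pair e0 x0.
Hypothesis sub_ok : subroutines_ok D2 g root opt elb e0 x0.

Local Notation run := (hec g root opt elb e0 x0).

Lemma hec_succ k : run k.+1 = hec_step g root opt elb (run k).
Proof. by []. Qed.

(** Expansion only increases the value [g ehat x = 0] left by contraction, so the
next pair brackets a root again. *)
Lemma hec_invariant k : hec_state_ok (run k).
Proof.
elim: k => [//|k]; rewrite hec_succ.
case E : (run k) => [e x|//] /= ex_ok.
have [root_ok opt_ok] := sub_ok E.
have [D1h /andP[lt_h le_h] g0] := contraction_spec ex_ok root_ok.
have [D1e D2x _ _] := ex_ok.
case: asboolP => [st | nst] /=; first by split.
have [D2x' _ g_lt] := expansion_spec D1h (opt_ok nst) nst.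
by split=> //; rewrite -g0 ltW.
Qed.

Lemma hec_succeeds : hec_steps_succeed D1 D2 g root opt elb e0 x0.
Proof.
move=> k e x E /=.
have ex_ok := hec_invariant k; rewrite E in ex_ok.
have [root_ok opt_ok] := sub_ok E.
have [D1h lt_h g0] := contraction_spec ex_ok root_ok.
have [D1e D2x _ _] := ex_ok.
by split=> // nst; exact: expansion_spec (opt_ok nst) nst.
Qed.

Variables (eps : nat -> R) (xs : nat -> 'rV[R]_N).
Hypothesis runE : forall k, run k = Running (eps k) (xs k).

Lemma hec_iterate_in k : bracketing_pair (eps k) (xs k).
Proof. by have := hec_invariant k; rewrite runE. Qed.

(** In the equation [g (eps k.+1) (xs k) = 0] the indices differ because the root
found for [xs k] is what becomes [eps k.+1]. *)
Lemma hec_iterate_step k :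
  [/\ eps k.+1 <= eps k, g (eps k.+1) (xs k) = 0
    & stationary (g (eps k.+1)) (xs k.+1)].
Proof.
have [_ _ /andP[_ le_h] g0 expand] := hec_succeeds (runE k).
have := runE k.+1; rewrite hec_succ runE /=.
case: asboolP => // nst [<- <-].
by have [_ st _] := expand nst.
Qed.

Lemma hec_eps_nonincreasing : nonincreasing_seq eps.
Proof. by apply/nonincreasing_seqP => k; have [] := hec_iterate_step k. Qed.

(** The limit stays in [D1] because it lies between [elb] and [eps 0]. *)
Lemma hec_eps_cvg : exists2 et, D1 et & eps @ \oo --> et.
Proof.
have eps_gt k : elb < eps k by have [] := hec_iterate_in k.
have cvg_eps : cvgn eps.
  apply: nonincreasing_is_cvgn; first exact: hec_eps_nonincreasing.
  by exists elb => _ [k _ <-]; exact: ltW.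
exists (limn eps) => //.
have [D1_0 _ _ _] := hec_iterate_in 0.
apply: (connected_between D1_connected D1_elb D1_0); apply/andP; split.
  by apply: limr_ge => //; apply: nearW => k; exact: ltW.
exact: nonincreasing_cvgn_ge hec_eps_nonincreasing cvg_eps 0%N.
Qed.

Lemma hec_cluster_nonempty : cluster (xs @ \oo) !=set0.
Proof.
have xs_D2 : \forall k \near \oo, D2 (xs k).
  by apply: nearW => k; have [] := hec_iterate_in k.
have [x [_ x_cluster]] :=
  @D2_compact (xs @ \oo) (fmap_proper_filter xs _) xs_D2.
by exists x.
Qed.

Lemma hec_cluster_pseudoroot et xt :
  D1 et -> eps @ \oo --> et -> cluster (xs @ \oo) xt ->
  pseudoroot D1 D2 g et xt.
Proof.
move=> D1et eps_cvg xt_cluster.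
have clD2 : closed D2 by apply: compact_closed => //; exact: norm_hausdorff.
have D2xt : D2 xt.
  have xs_D2 : \forall k \near \oo, D2 (xs k).
    by apply: nearW => k; have [] := hec_iterate_in k.
  by apply: clD2 => B; exact: xt_cluster.
split=> //.
  apply: (cluster_pair_zero (C1_pair_continuous g_C1 D1et D2xt)
    (u := fun k => eps k.+1) _ xt_cluster).
    by have := eps_cvg; rewrite -cvg_shiftS.
  by apply: nearW => k /=; have [] := hec_iterate_step k.
apply/stationary_partial => i.
apply: (cluster_pair_zero
  (C1_partial_continuous (v := delta_mx 0 i) g_C1 D1et D2xt) eps_cvg xt_cluster).
(* Index 0 is left out: [x0] need not be stationary for [g e0]. *)
apply: filterS (nbhs_infty_gt 0) => -[//|k] _ /=.
by have [_ _ /stationary_partial] := hec_iterate_step k.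
Qed.

End HECRun.

Theorem theorem3p7 (R : realType) (N : nat) (D1 : set R) (D2 : set 'rV[R]_N)
    (g : R -> 'rV[R]_N -> R) (f : R -> R) (elb e0 : R) (x0 : 'rV[R]_N)
    (root : root_finder R) (opt : optimizer R N)
    (D1_connected : connected D1)
    (D2_compact : compact D2)
    (g_C1 : C1_on_product D1 D2 g)
    (f_max : forall e, D1 e -> is_maximum (g e @` D2) (f e))
    (D1_elb : D1 elb) (D1_e0 : D1 e0) (elb_lt_e0 : elb < e0) (D2_x0 : D2 x0)
    (f_elb_lt0 : f elb < 0) (g_ge0 : 0 <= g e0 x0) (g_le_f : g e0 x0 <= f e0)
    (sub_ok : subroutines_ok D2 g root opt elb e0 x0) :
  hec_steps_succeed D1 D2 g root opt elb e0 x0 /\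
  ((exists (k : nat) (e : R) (x : 'rV[R]_N),
      hec g root opt elb e0 x0 k = Returned e x /\ pseudoroot D1 D2 g e x)
   \/
   (exists (eps : nat -> R) (xs : nat -> 'rV[R]_N) (et : R),
      [/\ forall k, hec g root opt elb e0 x0 k = Running (eps k) (xs k),
          nonincreasing_seq eps,
          eps @ \oo --> et,
          cluster (xs @ \oo) !=set0
        & forall xt, cluster (xs @ \oo) xt -> pseudoroot D1 D2 g et xt])).
Proof.
have g_elb_lt0 x : D2 x -> g elb x < 0.
  move=> D2x; have [_ ub] := f_max _ D1_elb.
  by apply: le_lt_trans f_elb_lt0; apply: ub; exists x.
have start_ok : bracketing_pair D1 D2 g elb e0 x0 by split.
split; first exact: hec_succeeds.
have [[k [e [x E]]] | never_returns] := pselect (exists k e x,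
    hec g root opt elb e0 x0 k = Returned e x).
  left; exists k, e, x; split=> //.
  have := hec_invariant D1_connected D2_compact g_C1 D1_elb g_elb_lt0
    start_ok sub_ok k.
  by rewrite E.
right.
pose eps k := match hec g root opt elb e0 x0 k with
  Running e _ => e | Returned e _ => e end.
pose xs k := match hec g root opt elb e0 x0 k with
  Running _ x => x | Returned _ x => x end.
have runE k : hec g root opt elb e0 x0 k = Running (eps k) (xs k).
  rewrite /eps /xs; case E : (hec _ _ _ _ _ _ k) => [e x|e x] //.
  by exfalso; apply: never_returns; exists k, e, x.
have [et D1et eps_cvg] := hec_eps_cvg D1_connected D2_compact g_C1 D1_elb
  g_elb_lt0 start_ok sub_ok runE.
exists eps, xs, et; split=> //.
- exact: (hec_eps_nonincreasing D1_connected D2_compact g_C1 D1_elb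
    g_elb_lt0 start_ok sub_ok runE).
- exact: (hec_cluster_nonempty D1_connected D2_compact g_C1 D1_elb
    g_elb_lt0 start_ok sub_ok runE).
- move=> xt; exact: (hec_cluster_pseudoroot D1_connected D2_compact g_C1 D1_elb
    g_elb_lt0 start_ok sub_ok runE D1et eps_cvg).
Qed.
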